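(* Let $S : X \to X$, $X = \Sigma_M^+ \times \widehat{\mathbb{C}}$, be the skew-product map associated with rational maps $R_1, \dots, R_M$ of the Riemann sphere, at least one of which has degree at least $2$. Let $f : X \to \mathbb{R}$ be a function. Suppose there exists a constant $\lambda_f > 1$ such that $E_S(f,n) \asymp (\lambda_f)^n$, i.e. there exist constants $\kappa_1, \kappa_2 > 0$ with $\kappa_1 \lambda_f^n \le E_S(f,n) \le \kappa_2 \lambda_f^n$ for all integers $n \ge 1$. Then, for any fixed real $k > 0$, $$\sum_{n \ge 1} \frac{C_S(f,n)}{n^k \lambda_f^n} \asymp \frac{1}{k},$$ i.e. for every real $k > 0$ there exist constants $\sigma_5, \sigma_6 > 0$ such that $\dfrac{\sigma_5}{k} \le \sum_{n \ge 1} \dfrac{C_S(f,n)}{n^k \lambda_f^n} \le \dfrac{\sigma_6}{k}$ (in particular the series converges).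
   Context: Let $R_1, \dots, R_M$ be finitely many rational maps acting on the Riemann sphere $\widehat{\mathbb{C}} = \mathbb{C} \cup \{\infty\}$, of degrees $r_1, \dots, r_M$ respectively, with at least one of the degrees at least $2$. Let $\Sigma_M^+$ be the set of infinite words $\omega = (\omega_1 \omega_2 \cdots)$ with letters in $\{1, \dots, M\}$, and let $\sigma$ be the shift, $(\sigma\omega)_j = \omega_{j+1}$ for $j \ge 1$. The skew-product map $S : X \to X$, $X = \Sigma_M^+ \times \widehat{\mathbb{C}}$, is $S(\omega, z_0) = (\sigma\omega, R_{\omega_1} z_0)$. For an integer $n \ge 1$, $\mathrm{Per}_n(S)$ is the set of points $p \in X$ with $S^n p = p$; the prime period $n_p$ of a periodic point $p$ is the least positive integer $m$ with $S^m p = p$. $\mathscr{O}_n(S)$ denotes the collection of all closed orbits of length $n$, i.e. sets $\tau = \{p, Sp, \dots, S^{n-1}p\}$ where $p$ is a periodic point with prime period exactly $n$. For $f : X \to \mathbb{R}$ the $n$-th ergodic sum is $f^n(p) = \sum_{j=0}^{n-1} f(S^j p)$, and for $\tau = \{p, Sp, \dots, S^{n-1}p\} \in \mathscr{O}_n(S)$ one puts $f^n(\tau) = f^n(p)$ (independent of the choice of $p \in \tau$). Define $$E_S(f,n) = \sum_{p \in \mathrm{Per}_n(S)} e^{f^{n_p}(p)}, \qquad C_S(f,n) = \sum_{\tau \in \mathscr{O}_n(S)} e^{f^n(\tau)}.$$ Sums of positive terms are understood a priori with values in $[0,\infty]$. The number $k$ is fixed before the comparability constants $\sigma_5,\sigma_6$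 are chosen, so these may depend on $k$. *)

(* Defs.v *)
From mathcomp Require Import all_boot all_order all_algebra.
From mathcomp Require Import complex.
From mathcomp Require Import all_classical all_reals all_analysis.

Set Implicit Arguments.
Unset Strict Implicit.
Unset Printing Implicit Defensive.

Import Order.TTheory GRing.Theory Num.Theory.
Local Open Scope classical_set_scope.
Local Open Scope ring_scope.

(* [None] is the point at infinity. *)
Definition sphere (R : realType) := option R[i].

(* A rational map is a quotient p / q in lowest terms; coprimality excludes
   (0, 0) but allows q = 0, which forces p to be a nonzero constant and gives
   the constant map infinity. *)
Record ratmap (R : realType) := RatMap {
  rnum : {poly R[i]};
  rden : {poly R[i]};
  ratmap_coprime : coprimep rnum rden }.

Definition rdeg (R : realType) (F : ratmap R) : nat :=
  maxn (size (rnum F)).-1 (size (rden F)).-1.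

(* A vanishing denominator means the value infinity: the numerator is then
   nonzero, by coprimality for finite points, and by definition of the degree
   for the coefficients of degree [rdeg F]. *)
Definition rquot (R : realType) (a b : R[i]) : sphere R :=
  if b == 0 then None else Some (a / b).

Definition rapp (R : realType) (F : ratmap R) (z : sphere R) : sphere R :=
  match z with
  | Some w => rquot (rnum F).[w] (rden F).[w]
  | None => rquot (rnum F)`_(rdeg F) (rden F)`_(rdeg F)
  end.

(* Infinite words; letters and positions are both numbered from 0. *)
Definition word (M : nat) := nat -> 'I_M.

Definition shift (M : nat) (w : word M) : word M := fun j => w j.+1.

Definition skew_product (R : realType) (M : nat) (F : 'I_M -> ratmap R)
    (x : word M * sphere R) : word M * sphere R :=
  (shift x.1, rapp (F (x.1 0%N)) x.2).

Section PeriodicOrbits.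
Context (R : realType) (T : choiceType) (S : T -> T) (f : T -> R).

Definition Per (n : nat) : set T := [set p | iter n S p = p].

Definition is_prime_period (p : T) (n : nat) : Prop :=
  [/\ (0 < n)%N, Per n p & forall m, (0 < m)%N -> Per m p -> (n <= m)%N].

(* The junk value 0 is only taken at non-periodic points. *)
Definition prime_period (p : T) : nat := xget 0%N (is_prime_period p).

Definition orbit_set (n : nat) (p : T) : set T :=
  [set iter j S p | j in [set j | (j < n)%N]].

Definition closed_orbits (n : nat) : set (set T) :=
  [set orbit_set n p | p in is_prime_period^~ n].

Definition ergodic_sum (n : nat) (p : T) : R :=
  \sum_(0 <= j < n) f (iter j S p).

(* The common value of the ergodic sum on a set of points; see
   [orbit_ergodic_sumE]. *)
Definition orbit_ergodic_sum (n : nat) (tau : set T) : R :=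
  xget 0 [set ergodic_sum n p | p in tau].

Definition E_sum (n : nat) : \bar R :=
  \esum_(p in Per n) (expR (ergodic_sum (prime_period p) p))%:E.

Definition C_sum (n : nat) : \bar R :=
  \esum_(tau in closed_orbits n) (expR (orbit_ergodic_sum n tau))%:E.

Lemma prime_periodE (p : T) (n : nat) :
  is_prime_period p n -> prime_period p = n.
Proof.
move=> pn; rewrite /prime_period; case: xgetP => [m _|/(_ n)//].
case: pn => n0 Pn nmin [m0 Pm mmin].
by apply/eqP; rewrite eqn_leq mmin// nmin.
Qed.

Lemma ergodic_sum_iter (n j : nat) (p : T) :
  Per n p -> ergodic_sum n (iter j S p) = ergodic_sum n p.
Proof.
move=> Pn; elim: j => [//|j <-].
have Pj : iter n S (iter j S p) = iter j S p by rewrite -iterD addnC iterD Pn.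
rewrite iterS; move: (iter j S p) Pj => q Pq; rewrite /ergodic_sum.
case: n Pq {Pn} => [|n] Pq; first by rewrite !big_nil.
rewrite big_nat_recr//= big_nat_recl//= addrC -iterSr Pq.
by congr (_ + _); apply: eq_bigr => i _; rewrite -iterSr.
Qed.

Lemma orbit_ergodic_sumE (n : nat) (tau : set T) (p : T) :
  closed_orbits n tau -> tau p -> orbit_ergodic_sum n tau = ergodic_sum n p.
Proof.
move=> [q [n0 Pq _] <-] [j _ <-]; rewrite /orbit_ergodic_sum.
case: xgetP => [x _ [_ [i _ <-] <-]|/(_ (ergodic_sum n q))[]].
  by rewrite !ergodic_sum_iter.
by exists q => //; exists 0%N.
Qed.

End PeriodicOrbits.

(* Main.v *)
Require Import Defs.
From mathcomp Require Import all_boot all_order all_algebra.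
From mathcomp Require Import complex.
From mathcomp Require Import all_classical all_reals all_analysis.
From mathcomp Require Import ring lra.
Import Order.TTheory GRing.Theory Num.Theory.
Local Open Scope classical_set_scope.
Local Open Scope ring_scope.

(** The sums [E_sum] and [C_sum] are compared by counting.  The points of prime
    period [n] are partitioned into closed orbits of exactly [n] points, on
    each of which the ergodic sum is constant, so [n * C_n] is the sum of
    [exp (f^n p)] over the points of prime period [n]
    ([C_sum_prime_period]).  This part holds for an arbitrary self-map of a
    set and has two consequences.

    Every periodic point of period 1 has prime period 1, hence [C_1 = E_1]
    ([E_sum1]), and the lower bound on [E_1] makes the first term of the
    series at least [kappa1].  All terms being nonnegative, [kappa1] bounds
    the whole series from below.

    The points of prime period [n] lie in [Per n], hence [n * C_n <= E_n]
    ([natmul_C_sum_le_E_sum]), and the [n]-th term of the series is at most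
    [kappa2 * n^-(k+1)].  Comparing [n^-(k+1)] with the increments of
    [- n^-k / k] gives [\sum n^-(k+1) <= 1 + 1/k] ([sum_powR_le]), so the
    series is at most [kappa2 * (k + 1) / k].  As the constants may depend on
    [k], [sigma5 = kappa1 * k] and [sigma6 = kappa2 * (k + 1)] will do. *)

Section Orbits.
Context {T : choiceType} (S : T -> T).

Lemma orbit_set_iter (n i : nat) (p : T) :
  (0 < n)%N -> Per S n p -> orbit_set S n p (iter i S p).
Proof.
move=> n0 Pp; exists (i %% n)%N; first exact: ltn_pmod.
rewrite {2}(divn_eq i n) addnC iterD; congr iter.
by rewrite iterM iter_fix.
Qed.

Lemma iter_subn_Per (n i : nat) (p : T) :
  (i < n)%N -> Per S n p -> iter (n - i) S (iter i S p) = p.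
Proof. by move=> /ltnW i_n Pp; rewrite -iterD subnK. Qed.

(** A period of a point is a period of its iterates, and some iterate of [q] is
    [p] again; so [p] and [q] have the same periods. *)
Lemma is_prime_period_orbit (n : nat) (p q : T) :
  is_prime_period S p n -> orbit_set S n p q -> is_prime_period S q n.
Proof.
move=> [n0 Pp pmin] [i /= i_n <-]; split=> //.
  by rewrite /Per/= -iterD addnC iterD Pp.
move=> m m0 /= Pm; apply: pmin => //; rewrite /Per/=.
rewrite -[in LHS](iter_subn_Per _ _ _ i_n Pp).
by rewrite -(iterD m) addnC iterD Pm iter_subn_Per.
Qed.

(** A point of a cycle leads back to the base point, so each of the two points
    generates the orbit of the other. *)
Lemma orbit_set_eq (n : nat) (p q : T) :
  is_prime_period S p n -> orbit_set S n p q ->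
  orbit_set S n q = orbit_set S n p.
Proof.
move=> pn pq; have [n0 Pq _] := is_prime_period_orbit _ _ _ pn pq.
have [_ Pp _] := pn; case: pq Pq => i /= i_n <- Pq.
apply/seteqP; split=> _ [j _ <-]; first by rewrite -iterD; exact: orbit_set_iter.
by rewrite -{2}(iter_subn_Per _ _ _ i_n Pp) -iterD; exact: orbit_set_iter.
Qed.

Lemma iter_inj_prime_period (n : nat) (p : T) :
  is_prime_period S p n -> set_inj `I_n (fun i => iter i S p).
Proof.
move=> [n0 Pp pmin].
suff lt_neq i j : (i < j < n)%N -> iter i S p <> iter j S p.
  move=> i j; rewrite !inE/= => i_n j_n eq_ij.
  have [ij|ji|//] := ltngtP i j; exfalso.
    by apply: (lt_neq i j); rewrite ?ij.
  by apply: (lt_neq j i); rewrite ?ji.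
move=> /andP[ij j_n] eq_ij.
have : (n <= n - j + i)%N.
  apply: pmin; first by rewrite addn_gt0 subn_gt0 j_n.
  by rewrite /Per/= iterD eq_ij iter_subn_Per.
by rewrite leqNgt -ltn_subRL subKn ?ij// ltnW.
Qed.
End Orbits.

Lemma sum_ord_const {R : realType} (n : nat) (x : \bar R) :
  (\sum_(i < n) x = n%:R%:E * x)%E.
Proof.
rewrite -[in RHS](card_ord n) -sumr_const -sumEFin ge0_sume_distrl//.
by apply: eq_bigr => i _; rewrite mul1e.
Qed.

Section OrbitSums.
Context {R : realType} {T : choiceType} (S : T -> T) (f : T -> R).

(** Both sides are the double sum over pairs of an orbit and one of its points:
    each orbit has [n] points of equal weight, and each point of prime period
    [n] lies on exactly one orbit. *)
Lemma C_sum_prime_period (n : nat) :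
  (n%:R%:E * C_sum S f n =
   \esum_(p in (is_prime_period S)^~ n) (expR (ergodic_sum S f n p))%:E)%E.
Proof.
pose g p : \bar R := (expR (ergodic_sum S f n p))%:E.
have g0 p : (0 <= g p)%E by rewrite lee_fin expR_ge0.
rewrite -/(g _) (reindex_esum (closed_orbits S n `*`` id) _ snd); last first.
  split.
  - move=> [tau p] [/= [q qn <-] qp] /=.
    exact: is_prime_period_orbit qn qp.
  - move=> [_ p] [_ p'] /[!inE] -[/= [q qn <-] qp] [/= [q' q'n <-] q'p'] /= pp'.
    rewrite -pp' in q'p' *.
    by rewrite -(orbit_set_eq _ _ _ _ qn qp) -(orbit_set_eq _ _ _ _ q'n q'p').
  move=> p pn /=; exists (orbit_set S n p, p) => //; split => /=.
    by exists p.
  by have [n0 Pp _] := pn; exact: (orbit_set_iter _ n 0).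
rewrite -(@esum_esum _ _ _ _ id (fun=> g)) => [|tau p _ _]; last exact: g0.
rewrite /C_sum -sum_ord_const -esum_sum => [|tau i _ _]; last first.
  by rewrite lee_fin expR_ge0.
apply: eq_esum => tau tau_n; have [q qn qtau] := tau_n.
rewrite -[in RHS]qtau esum_image; last exact: iter_inj_prime_period.
rewrite esum_fset// -fsbig_ord; apply: eq_bigr => i _; rewrite /g.
by rewrite (orbit_ergodic_sumE f (p := iter i S q) tau_n)// -qtau; exists i => /=.
Qed.

Lemma E_sum1 : E_sum S f 1 = C_sum S f 1.
Proof.
have := C_sum_prime_period 1; rewrite mul1e /E_sum => ->.
have P1 : Per S 1 = (is_prime_period S)^~ 1%N.
  by apply/seteqP; split=> [p Pp|p []].
rewrite P1; apply: eq_esum => p p1.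
by rewrite (prime_periodE p1).
Qed.

Lemma natmul_C_sum_le_E_sum (n : nat) : (n%:R%:E * C_sum S f n <= E_sum S f n)%E.
Proof.
rewrite C_sum_prime_period.
rewrite (@eq_esum _ _ _ _
    (fun p => (expR (ergodic_sum S f (prime_period S p) p))%:E)); last first.
  by move=> p pn; rewrite (prime_periodE pn).
apply: le_ereal_sup; apply: image_subset => A [finA A_n]; split=> //.
by move=> p /A_n[].
Qed.

Lemma C_sum_ge0 (n : nat) : (0 <= C_sum S f n)%E.
Proof. by apply: esum_ge0 => tau _; rewrite lee_fin expR_ge0. Qed.
End OrbitSums.

(** The mean value inequality for [x^-k] on [[n, n+1]].  Dividing by [(n+1)^-k]
    turns it into [1 + k / (n+1) <= (1 - 1/(n+1))^-k], which follows from
    [1 + x <= exp x] at [x = - k * ln (1 - 1/(n+1))] together with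
    [ln (1 - y) <= - y]. *)
Lemma powR_step_le {R : realType} (k : R) (n : nat) : 0 < k -> (0 < n)%N ->
  k * n.+1%:R `^ (- (k + 1)) <= n%:R `^ (- k) - n.+1%:R `^ (- k).
Proof.
move=> k0 n0; have n0R : 0 < n%:R :> R by rewrite ltr0n.
have n1R : 0 < n.+1%:R :> R by rewrite ltr0n.
have -> : n%:R `^ (- k) = n.+1%:R `^ (- k) * expR (- k * ln (1 - n.+1%:R^-1)).
  rewrite (_ : 1 - _ = n%:R / n.+1%:R); last first.
    by rewrite -[n%:R](addrK 1) natr1 mulrBl divff ?gt_eqF// mul1r.
  rewrite /powR !gt_eqF// -expRD -mulrDr lnM ?posrE ?invr_gt0//.
  by rewrite lnV ?posrE// addrCA subrr addr0.
rewrite opprD powRD; last by apply/implyP => _; rewrite gt_eqF.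
rewrite powR_inv1// mulrCA -[X in _ <= _ - X]mulr1 -mulrBr.
rewrite ler_wpM2l ?powR_ge0// lerBrDl (le_trans _ (expR_ge1Dx _))// lerD2l.
rewrite mulNr -mulrN ler_wpM2l ?(ltW k0)// lerNr le_ln1Dx//.
by rewrite ltrN2 invf_lt1// ltr1n.
Qed.

Lemma sum_powR_le {R : realType} (k : R) (N : nat) : 0 < k ->
  \sum_(1 <= n < N) n%:R `^ (- (k + 1)) <= 1 + k^-1.
Proof.
move=> k0; have [N1|] := leqP N 1.
  by rewrite big_geq// addr_ge0// invr_ge0 ltW.
case: N => [//|[//|N _]].
(* The subtracted term makes the bound inductive: the sum telescopes. *)
suff : \sum_(1 <= n < N.+2) n%:R `^ (- (k + 1)) <=
    1 + k^-1 - k^-1 * N.+1%:R `^ (- k).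
  by move=> /le_trans; apply; rewrite gerBl mulr_ge0 ?powR_ge0 ?invr_ge0 ?ltW.
elim: N => [|N IHN]; first by rewrite big_nat1 !powR1 mulr1 addrK.
rewrite big_nat_recr//= (le_trans (lerD IHN (lexx _)))//.
have := powR_step_le k N.+1 k0 isT.
rewrite -(ler_pM2l (_ : 0 < k^-1)) ?invr_gt0// mulrA mulVf ?gt_eqF// mul1r.
by rewrite mulrBr; lra.
Qed.

Lemma nneseries_le {R : realType} (u : nat -> \bar R) (m : nat) (l : \bar R) :
  (forall n, (m <= n)%N -> 0 <= u n)%E ->
  (forall N, \sum_(m <= n < N) u n <= l)%E -> (\sum_(m <= n <oo) u n <= l)%E.
Proof.
move=> u0 ul; apply: lime_le; last exact: nearW.
by apply: is_cvg_nneseries => n /u0.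
Qed.

Theorem theorem2p4 (R : realType) (M : nat) (F : 'I_M -> ratmap R)
    (hdeg : exists i : 'I_M, (2 <= rdeg (F i))%N)
    (f : word M * sphere R -> R) (lam : R) (hlam : 1 < lam)
    (hE : exists kappa1 kappa2 : R, [/\ 0 < kappa1, 0 < kappa2 &
       forall n : nat, (1 <= n)%N ->
         ((kappa1 * lam ^+ n)%:E <= E_sum (skew_product F) f n)%E /\
         (E_sum (skew_product F) f n <= (kappa2 * lam ^+ n)%:E)%E]) :
  forall k : R, 0 < k ->
  exists sigma5 sigma6 : R, [/\ 0 < sigma5, 0 < sigma6,
    ((sigma5 / k)%:E <= \sum_(1 <= n <oo)
       (C_sum (skew_product F) f n / (n%:R `^ k * lam ^+ n)%:E))%E &
    (\sum_(1 <= n <oo)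
       (C_sum (skew_product F) f n / (n%:R `^ k * lam ^+ n)%:E)
     <= (sigma6 / k)%:E)%E].
Proof.
move=> k k0; have lam0 : 0 < lam := lt_trans ltr01 hlam.
case: hE => kappa1 [kappa2 [kappa1_gt0 kappa2_gt0 hE]].
set u := fun n => (C_sum (skew_product F) f n / (n%:R `^ k * lam ^+ n)%:E)%E.
have w0 n : (1 <= n)%N -> 0 < n%:R `^ k * lam ^+ n.
  by move=> n1; rewrite mulr_gt0 ?exprn_gt0 ?powR_gt0 ?ltr0n.
have u0 n : (1 <= n)%N -> (0 <= u n)%E.
  by move=> n1; rewrite /u inver gt_eqF ?w0// mule_ge0 ?C_sum_ge0// lee_fin
    invr_ge0 ltW ?w0.
exists (kappa1 * k), (kappa2 * (k + 1)).
split; rewrite ?mulr_gt0 ?addr_gt0//.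
  rewrite mulfK ?gt_eqF//.
  apply: le_trans (nneseries_lim_ge 2 (fun n n1 _ => u0 n n1)).
  rewrite big_nat1 /u powR1 mul1r expr1 inver gt_eqF// lee_pdivlMr//.
  by rewrite -E_sum1 -EFinM -[X in kappa1 * X]expr1; have [] := hE 1%N isT.
have u_le n : (1 <= n)%N -> (u n <= (kappa2 * n%:R `^ (- (k + 1)))%:E)%E.
  move=> n1; rewrite /u inver gt_eqF ?w0// lee_pdivrMr ?w0//.
  have n0 : 0 < n%:R :> R by rewrite ltr0n.
  rewrite opprD powRD; last by apply/implyP => _; rewrite gt_eqF.
  rewrite powR_inv1 ?ler0n// -EFinM.
  rewrite (_ : kappa2 * _ * _ = n%:R^-1 * (kappa2 * lam ^+ n)); last first.
    by rewrite powRN; field; rewrite !gt_eqF// powR_gt0.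
  rewrite EFinM lee_pdivlMl// (le_trans (natmul_C_sum_le_E_sum _ _ _))//.
  by have [] := hE n n1.
apply: nneseries_le => // N.
rewrite big_nat_cond.
apply: (@le_trans _ _ (\sum_(1 <= n < N | ((1 <= n < N) && true)%N)
   (kappa2 * n%:R `^ (- (k + 1)))%:E)%E).
  by apply: lee_sum => n /andP[/andP[n1 _] _]; exact: u_le.
rewrite -big_nat_cond sumEFin lee_fin -mulr_sumr -mulrA.
rewrite ler_wpM2l ?(ltW kappa2_gt0)//.
by rewrite mulrDl divff ?gt_eqF// mul1r sum_powR_le.
Qed.
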